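(* Let $\sum_{n=1}^\infty a_n$ be a series of strictly positive real numbers. (i) If $X$ is a topological space that is compact, connected, and Hausdorff, or if $X$ is a path-connected topological space, then any continuous map $f:X\rightarrow \mathbb{N}_{a_n}$ is constant. (ii) If $Y$ is a metrizable topological space and $\sum_{n=1}^\infty a_n$ diverges, then any continuous function $f:\mathbb{N}_{a_n}\rightarrow Y$ is constant.
   Context: $\mathbb{N}=\{1,2,3,\dots\}$. For a series $\sum_{n=1}^\infty a_n$ of strictly positive real numbers and $A\subseteq\mathbb{N}$, write $\sum_A a_n=\sum_{n\in A}a_n\in[0,\infty]$. $\mathbb{N}_{a_n}$ denotes the set $\mathbb{N}$ with the topology whose closed sets are exactly $\mathbb{N}$ itself and all $A\subseteq\mathbb{N}$ with $\sum_A a_n<\infty$. *)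

(* Defs.v *)
From HB Require Import structures.
From mathcomp Require Import all_boot all_order all_algebra.
From mathcomp Require Import all_classical all_reals all_analysis.

Set Implicit Arguments.
Unset Strict Implicit.
Unset Printing Implicit Defensive.

Import Order.TTheory GRing.Theory Num.Theory.
Import numFieldNormedType.Exports.

Local Open Scope classical_set_scope.
Local Open Scope ring_scope.

(* Terms are indexed from 0, as in the library: [n : nat] stands for the
   positive integer [n.+1].  [series_space a_gt0] is an alias of [nat], so that
   it does not inherit the discrete topology; the positivity proof is a parameter
   because the topology axioms need nonnegative terms. *)
Definition series_space (R : realType) (a : nat -> R)
  (a_gt0 : forall n, 0 < a n) : Type := nat.

Section series_space_topology.
Context (R : realType) (a : nat -> R) (a_gt0 : forall n, 0 < a n).

HB.instance Definition _ := Choice.copy (series_space a_gt0) nat.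

Definition series_space_closed : set_system (series_space a_gt0) :=
  [set A | A = setT \/ (\esum_(n in A) (a n)%:E < +oo)%E].

Definition series_space_open : set_system (series_space a_gt0) :=
  [set A | series_space_closed (~` A)].

Let a_ge0 n : (0 <= (a n)%:E)%E. Proof. by rewrite lee_fin ltW. Qed.

Let series_space_closedS A B :
  A `<=` B -> (\esum_(n in B) (a n)%:E < +oo)%E -> series_space_closed A.
Proof.
move=> AB Boo; right; apply: le_lt_trans Boo.
rewrite [leLHS]esum_mkcond [leRHS]esum_mkcond; apply: le_esum => n _.
have [/[!inE] An|_] := boolP (n \in A); last by case: ifP.
by rewrite ifT// inE; exact: AB.
Qed.

Let series_space_openT : series_space_open setT.
Proof. by right; rewrite setCT esum_set0. Qed.

Let series_space_openI : setI_closed series_space_open.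
Proof.
move=> A B [AT|Aoo]; first by left; rewrite setCI AT setTU.
move=> [BT|Boo]; first by left; rewrite setCI BT setUT.
right; rewrite setCI.
apply: (@le_lt_trans _ _
    (\esum_(n in ~` A) (a n)%:E + \esum_(n in ~` B) (a n)%:E)%E); last first.
  exact: lte_add_pinfty.
rewrite [leLHS]esum_mkcond [X in (_ <= X + _)%E]esum_mkcond.
rewrite [X in (_ <= _ + X)%E]esum_mkcond -esumD; last 2 first.
- by move=> n _; case: ifP.
- by move=> n _; case: ifP.
apply: le_esum => n _; rewrite in_setU.
by case: (n \in ~` A); case: (n \in ~` B); rewrite /= ?adde0 ?add0e ?leeDl.
Qed.

Let series_space_open_bigU (I : Type) (f : I -> set (series_space a_gt0)) :
  (forall i, series_space_open (f i)) -> series_space_open (\bigcup_i f i).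
Proof.
move=> fo; have [[i fioo]|fT] :=
    pselect (exists i, (\esum_(n in ~` f i) (a n)%:E < +oo)%E).
  by apply: series_space_closedS fioo; apply: subsetC; exact: bigcup_sup.
left; rewrite setC_bigcup; apply/seteqP; split => // n _ i _.
by case: (fo i) => [->//|fioo]; exfalso; apply: fT; exists i.
Qed.

HB.instance Definition _ := @isOpenTopological.Build (series_space a_gt0)
  series_space_open series_space_openT series_space_openI
  series_space_open_bigU.

Lemma closed_series_spaceE (A : set (series_space a_gt0)) :
  closed A <-> A = setT \/ (\esum_(n in A) (a n)%:E < +oo)%E.
Proof.
rewrite -openC /open/= /series_space_open/= setCK.
exact: iff_refl.
Qed.

End series_space_topology.

Definition path_connected_space (R : realType) (X : topologicalType) : Prop :=
  forall x y : X, exists g : R -> X,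
    [/\ {within `[0, 1], continuous g}, g 0 = x & g 1 = y].

Definition metrizable_space (R : realType) (Y : topologicalType) : Prop :=
  exists d : Y -> Y -> R,
    [/\ forall x y, d x y = 0 <-> x = y,
        forall x y, d x y = d y x,
        forall x y z, d x z <= d x y + d y z
      & forall U : set Y, open U <->
          forall x, U x -> exists2 e, 0 < e & [set y | d x y < e] `<=` U].

Definition is_constant (T U : Type) (f : T -> U) : Prop :=
  exists c, forall x, f x = c.

(* Main.v *)
(** Part (i) is Sierpinski's theorem: a continuum [K] carries no nonconstant
    map to [nat] with closed fibres.  Boundary bumping produces, for each [n],
    a subcontinuum of [K] that misses the fibre over [n] and on which the map is
    still nonconstant; iterating over all [n] yields a decreasing sequence of
    nonempty compact sets with empty intersection.  The fibres of a continuous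
    map to [series_space] are closed because points have finite sum.

    Part (ii): disjoint nonempty open sets of [series_space] have complements of
    finite sum covering [nat], so the series converges. *)
Require Import Defs.
From mathcomp Require Import all_boot all_order all_algebra.
From mathcomp Require Import all_classical all_reals all_analysis.

Set Implicit Arguments.
Unset Strict Implicit.
Unset Printing Implicit Defensive.

Import Order.TTheory GRing.Theory Num.Theory.
Import numFieldNormedType.Exports.

Local Open Scope classical_set_scope.
Local Open Scope ring_scope.

(** * Compactness for directed families, and separation of compact sets *)

Section compact_sets.
Context {T : topologicalType}.
Implicit Types (K A B O U : set T) (D : set (set T)).

(** If no member of [D] fits in [O], the sets [A \ O] generate a proper filter. Its cluster point in
    [K] lies in every closed [A], hence in [O], although the filter contains the complement of
    [O]. *)
Lemma compact_directed_bigcap D K O : D K -> compact K ->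
  (forall A, D A -> closed A) -> (forall A B, D A -> D B -> D (A `&` B)) ->
  open O -> \bigcap_(A in D) A `<=` O -> exists2 A, D A & A `<=` O.
Proof.
move=> DK cK Dcl DI oO DO; apply: contrapT => nDO.
pose F := filter_from D (fun A => A `\` O).
have FF : ProperFilter F.
  apply: filter_from_proper => [|A DA].
    apply: filter_from_filter; first by exists K.
    by move=> A B DA DB; exists (A `&` B); [exact: DI|move=> x [[]]].
  apply/set0P/negP => /eqP AO; apply: nDO; exists A => //.
  by rewrite -setD_eq0.
have FD A : D A -> F A by move=> DA; exists A => // x [].
have [x [Kx Fx]] := cK F FF (FD _ DK).
have Ox : O x.
  by apply: DO => A DA; apply: (Dcl A DA) => U Ux; exact: Fx (FD _ DA) Ux.
have FnO : F (~` O) by exists K => // y [].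
have [y [nOy Oy]] := Fx _ _ FnO (open_nbhs_nbhs (conj oO Ox)).
exact: nOy.
Qed.

Hypothesis hT : hausdorff_space T.

Lemma compact_point_separation K x : compact K -> ~ K x ->
  exists2 U, open U /\ U x & closure U `&` K = set0.
Proof.
move=> cK nKx.
(* Any closed [C] above [closure U] is allowed because the closure of an intersection is only
   included in the intersection of the closures; this makes [D] stable under intersection. *)
pose D := [set A | exists2 U, open U /\ U x & exists2 C, closed C &
  closure U `<=` C /\ A = C `&` K].
have [||||A [U [oU Ux] [C _ [UC ->]]] A0] :=
    @compact_directed_bigcap D K set0 _ cK _ _ open0.
- exists setT; first by split=> //; exact: openT.
  by exists setT; [exact: closedT|rewrite setTI].
- move=> A [U _ [C cC [_ ->]]]; apply: closedI => //; exact: compact_closed.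
- move=> A B [U [oU Ux] [C cC [UC ->]]] [V [oV Vx] [E cE [VE ->]]].
  exists (U `&` V); first by split; [exact: openI|].
  exists (C `&` E); first exact: closedI.
  split; last by rewrite setIACA setIid.
  by move=> y /closureI[/UC ? /VE].
- move=> y Dy.
  have Ky : K y.
    have [|//] := Dy (setT `&` K).
    exists setT; first by split=> //; exact: openT.
    by exists setT; [exact: closedT|].
  (* A point common to all members of [D] is a cluster point of the neighbourhoods of [x], so it is
     [x]. *)
  apply: nKx; rewrite (_ : x = y)//; apply: hT => U V /nbhs_interior Ux Vy.
  have [|Uy _] := Dy (closure U° `&` K).
    exists U°.
      by split; [exact: open_interior|exact: nbhs_singleton].
    exists (closure U°); first exact: closed_closure.
    by split; first exact: subset_refl.
  have [z [Uz Vz]] := Uy _ Vy.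
  by exists z; split => //; exact: interior_subset.
exists U => //; rewrite -subset0; apply: subset_trans A0.
exact: setSI.
Qed.

(** Same scheme with [A] in place of the point. A given [y] in [B] is excluded by the complement of
    [closure V], where [V] is a neighbourhood of [y] whose closure misses [A]. *)
Lemma compact_separation A B : compact A -> compact B -> A `&` B = set0 ->
  exists2 U, open U /\ A `<=` U & closure U `&` B = set0.
Proof.
move=> cA cB AB0.
pose D := [set Z | exists2 U, open U /\ A `<=` U & exists2 C, closed C &
  closure U `<=` C /\ Z = C `&` B].
have [||||Z [U [oU AU] [C _ [UC ->]]] Z0] :=
    @compact_directed_bigcap D B set0 _ cB _ _ open0.
- exists setT; first by split=> //; exact: openT.
  by exists setT; [exact: closedT|rewrite setTI].
- move=> Z [U _ [C cC [_ ->]]]; apply: closedI => //; exact: compact_closed.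
- move=> Z1 Z2 [U [oU AU] [C cC [UC ->]]] [V [oV AV] [E cE [VE ->]]].
  exists (U `&` V); first by split; [exact: openI|rewrite subsetI].
  exists (C `&` E); first exact: closedI.
  split; last by rewrite setIACA setIid.
  by move=> y /closureI[/UC ? /VE].
- move=> y Dy.
  have By : B y.
    have [|//] := Dy (setT `&` B).
    exists setT; first by split=> //; exact: openT.
    by exists setT; [exact: closedT|].
  have nAy : ~ A y by move=> Ay; have : (A `&` B) y by []; rewrite AB0.
  have [V [oV Vy] VA0] := compact_point_separation cA nAy.
  have [|Uy _] := Dy (closure (~` closure V) `&` B).
    exists (~` closure V); last first.
      exists (closure (~` closure V)); first exact: closed_closure.
      by split; first exact: subset_refl.
    split; first exact/closed_openC/closed_closure.
    by apply/disjoints_subset; rewrite setIC.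
  have [z [nVz Vz]] := Uy _ (open_nbhs_nbhs (conj oV Vy)).
  by apply: nVz; exact: subset_closure.
exists U => //; rewrite -subset0; apply: subset_trans Z0.
exact: setSI.
Qed.

End compact_sets.

(** * Quasi-components, boundary bumping and Sierpinski's theorem *)

Section continua.
Context {T : topologicalType}.
Hypothesis hT : hausdorff_space T.
Implicit Types (K C U Z : set T).

(* For closed [K], the members are the subsets containing [x] that are clopen
   relatively to [K]. *)
Definition relative_clopens K (x : T) : set (set T) :=
  [set Z | [/\ Z `<=` K, Z x, closed Z & closed (K `\` Z)]].

Definition quasi_component K (x : T) : set T :=
  \bigcap_(Z in relative_clopens K x) Z.

Section quasi_component_theory.
Variables (K : set T) (x : T).
Hypotheses (cK : compact K) (Kx : K x).

Lemma relative_clopensK : relative_clopens K x K.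
Proof.
by split => //; [exact: compact_closed|rewrite setDv; exact: closed0].
Qed.

Lemma quasi_component_sub : quasi_component K x `<=` K.
Proof. by move=> y; apply; exact: relative_clopensK. Qed.

Lemma quasi_component_refl : quasi_component K x x.
Proof. by move=> Z []. Qed.

Lemma quasi_component_closed : closed (quasi_component K x).
Proof. by apply: closed_bigI => Z []. Qed.

Lemma quasi_component_compact : compact (quasi_component K x).
Proof.
exact: subclosed_compact quasi_component_closed cK quasi_component_sub.
Qed.

Lemma quasi_component_open_nbhs U : open U -> quasi_component K x `<=` U ->
  exists2 Z, relative_clopens K x Z & Z `<=` U.
Proof.
apply: (compact_directed_bigcap relative_clopensK cK); first by move=> Z [].
move=> A B [AK Ax Acl KAcl] [BK Bx Bcl KBcl]; split => //.
- by move=> y [/AK].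
- exact: closedI.
- by rewrite setDIr; exact: closedU.
Qed.

(** Two separated pieces would be disjoint compact sets, hence separated by an open [U]. Some
    relative clopen [Z] avoids the boundary of [U], and cutting [Z] along [U] gives a smaller
    relative clopen that keeps [x] but loses the other piece. *)
Lemma quasi_component_connected : connected (quasi_component K x).
Proof.
apply/connectedP => E [E0 EQ sE].
wlog Ex : E E0 EQ sE / E false x.
  move=> wl; have := quasi_component_refl; rewrite EQ => -[|Ex]; first exact: wl.
  by apply: (wl (E \o negb)) => //=; [rewrite setUC|rewrite separatedC].
have Ecl b : closed (E b).
  move=> y Ey.
  have : quasi_component K x y.
    apply: quasi_component_closed; apply: closureS Ey => z Ez.
    by rewrite EQ; case: b Ez; [right|left].
  case: sE => s1 s2; rewrite EQ; case: b Ey => Ey [] // Ey'; exfalso.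
    by have : (E false `&` closure (E true)) y by []; rewrite s2.
  by have : (closure (E false) `&` E true) y by []; rewrite s1.
have Eco b : compact (E b).
  apply: (subclosed_compact (Ecl b) quasi_component_compact).
  by rewrite EQ; case: b => y; [right|left].
have [U [oU EU] UE] :=
  compact_separation hT (Eco false) (Eco true) (separated_disjoint sE).
have [||Z [ZK Zx Zcl KZcl] ZU] :=
    @quasi_component_open_nbhs (U `|` ~` closure U).
- by apply: openU => //; exact/closed_openC/closed_closure.
- rewrite EQ; apply: setUSS => //.
  by apply/disjoints_subset; rewrite setIC.
(* On [Z], the sets [U] and [closure U] agree: the second form shows that the cut is closed, the
   first that its complement in [K] is. *)
have clU : relative_clopens K x (Z `&` closure U).
  split.
  - by move=> y [/ZK].
  - by split => //; apply: subset_closure; exact: EU.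
  - by apply: closedI => //; exact: closed_closure.
  - rewrite setDIr (_ : _ `|` _ = (K `\` Z) `|` (Z `&` ~` U)).
      by apply: closedU => //; apply: closedI => //; exact: open_closedC.
    apply/seteqP; split => y.
      move=> [|[Ky nUy]]; first by left.
      have [Zy|nZy] := pselect (Z y); last by left.
      by right; split=> // Uy; apply: nUy; exact: subset_closure.
    move=> [|[Zy nUy]]; first by left.
    by right; split; [exact: ZK|have [] := ZU _ Zy].
have [y Ey] := E0 true.
have : (closure U `&` E true) y.
  split => //; have Qy : quasi_component K x y by rewrite EQ; right.
  by have [] := Qy _ clU.
by rewrite UE.
Qed.

End quasi_component_theory.

(** [Q] is the quasi-component of [x] in [C] intersected with [closure U]. Were it inside [U], so
    would be some relative clopen [Z]; then [Z] would be clopen in the connected [C], forcing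
    [Z = C] inside [U]. *)
Lemma boundary_bumping C U x : compact C -> connected C -> open U ->
  C x -> U x -> ~ (C `<=` U) ->
  exists Q, [/\ Q `<=` C `&` closure U, compact Q, connected Q, Q x &
    ~ (Q `<=` U)].
Proof.
move=> cC kC oU Cx Ux nCU.
have clC : closed C by exact: compact_closed.
have cK : compact (C `&` closure U).
  apply: (subclosed_compact _ cC); last exact: subIsetl.
  by apply: closedI => //; exact: closed_closure.
have Kx : (C `&` closure U) x by split => //; exact: subset_closure.
exists (quasi_component (C `&` closure U) x); split.
- exact: quasi_component_sub.
- exact: quasi_component_compact.
- exact: quasi_component_connected.
- exact: quasi_component_refl.
move=> QU; apply: nCU.
have [Z [ZK Zx Zcl KZcl] ZU] := quasi_component_open_nbhs cK Kx oU QU.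
rewrite -(kC Z) //; first by exists x.
(* This open set has trace [Z] on [C], since removing the closed remainder leaves only points of [Z]
   there. *)
- exists (U `\` ((C `&` closure U) `\` Z)).
    by rewrite setDE; apply: openI => //; exact: closed_openC.
  apply/seteqP; split => y.
    by move=> Zy; have [Cy _] := ZK _ Zy; split=> //; split; [exact: ZU|case].
  move=> [Cy [Uy nZy]]; apply: contrapT => nZ; apply: nZy; split => //.
  by split => //; exact: subset_closure.
- exists Z => //; apply/seteqP; split => y; last by case.
  by move=> Zy; have [] := ZK _ Zy.
Qed.

Variable f : T -> nat.

(** Fibres are intersected with [C] because, for a path, the map is controlled only on the unit
    segment. *)
Definition nonconstant_continuum C : Prop :=
  [/\ compact C, connected C, forall n, closed (C `&` f @^-1` [set n]) &
    exists x y, [/\ C x, C y & f x <> f y]].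

(** Choose [x] with [f x <> n] and an open [U] around its fibre whose closure misses the fibre over
    [n]. Boundary bumping gives a continuum inside [closure U], so avoiding [n], that leaves [U], so
    on which [f] takes a value other than [f x]. *)
Lemma nonconstant_continuum_avoid C n : nonconstant_continuum C ->
  exists C', [/\ nonconstant_continuum C', C' `<=` C &
    forall z, C' z -> f z <> n].
Proof.
move=> [cC kC fC [x0 [y0 [Cx0 Cy0 xy0]]]].
have [x [Cx xn]] : exists x, C x /\ f x <> n.
  have [x0n|x0n] := pselect (f x0 = n); last by exists x0.
  by exists y0; split => // y0n; apply: xy0; rewrite x0n y0n.
have cF k : compact (C `&` f @^-1` [set k]).
  by apply: (subclosed_compact (fC k) cC); exact: subIsetl.
have FF0 : (C `&` f @^-1` [set f x]) `&` (C `&` f @^-1` [set n]) = set0.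
  by rewrite -subset0 => z [[_ /= zx] [_ /= zn]]; apply: xn; rewrite -zx.
have [U [oU FU] UF] := compact_separation hT (cF _) (cF _) FF0.
have Ux : U x by exact: FU.
have sub Q : Q `<=` C -> compact Q -> forall k, closed (Q `&` f @^-1` [set k]).
  move=> QC cQ k; rewrite -(setIidl QC) -setIA.
  by apply: closedI => //; exact: compact_closed.
(* If [n] is not a value on [C], then [C] itself serves; otherwise a point over [n] shows that [C]
   is not inside [U]. *)
have [nCU|] := pselect (exists z, C z /\ f z = n); last first.
  move=> nCn; exists C; split => //; first by split => //; exists x0, y0.
  by move=> z Cz zn; apply: nCn; exists z.
have [|Q [QC cQ kQ Qx nQU]] := boundary_bumping cC kC oU Cx Ux.
  move=> CU; have [z [Cz zn]] := nCU.
  have : (closure U `&` (C `&` f @^-1` [set n])) z.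
    by split=> //; apply: subset_closure; exact: CU.
  by rewrite UF.
have {}QC : Q `<=` C /\ Q `<=` closure U by rewrite -subsetI.
have [QsubC QU] := QC.
exists Q; split => //.
- split => //; first exact: sub.
  have /existsNP[y /not_implyP[Qy nUy]] := nQU.
  exists x, y; split => // xy; apply: nUy; apply: FU.
  by split; [exact: QsubC|rewrite /= xy].
- move=> z Qz zn.
  have : (closure U `&` (C `&` f @^-1` [set n])) z.
    by split; [exact: QU|split=> //; exact: QsubC].
  by rewrite UF.
Qed.

Theorem sierpinski_continuum K : compact K -> connected K ->
  (forall n, closed (K `&` f @^-1` [set n])) ->
  forall x y, K x -> K y -> f x = f y.
Proof.
move=> cK kK fK x y Kx Ky; apply: contrapT => xy.
have PK : nonconstant_continuum K by split=> //; exists x, y.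
(* To make [next] total, [set0] is the dummy value outside nonconstant continua. *)
have /choice[next nextP] : forall nC : nat * set T, exists C',
    nonconstant_continuum nC.2 ->
    [/\ nonconstant_continuum C', C' `<=` nC.2 & forall z, C' z -> f z <> nC.1].
  move=> [n C] /=.
  have [PC|nPC] := pselect (nonconstant_continuum C); last by exists set0.
  by have [C' C'P] := nonconstant_continuum_avoid n PC; exists C'.
pose C := fix C n := if n is m.+1 then next (m, C m) else K.
have PC n : nonconstant_continuum (C n).
  by elim: n => //= n /(nextP (n, _))[].
have CS n : C n.+1 `<=` C n by have [] := nextP (n, C n) (PC n).
have Cmono m n : (m <= n)%N -> C n `<=` C m.
  move=> /subnKC <-; elim: (n - m)%N => [|k ih]; first by rewrite addn0.
  by rewrite addnS; exact: subset_trans (CS _) ih.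
have [||||_ [n _ <-] Cn0] :=
    @compact_directed_bigcap _ (range C) K set0 _ cK _ _ open0.
- by exists 0%N.
- by move=> _ [n _ <-]; have [cn _ _ _] := PC n; exact: compact_closed.
- move=> _ _ [m _ <-] [n _ <-]; exists (maxn m n) => //.
  have [mn|/ltnW nm] := leqP m n.
    by rewrite setIC; apply/esym/setIidl; exact: Cmono.
  by apply/esym/setIidl; exact: Cmono.
(* The value [n] is removed in passing from [C n] to [C n.+1], so [z] is already absent from
   [C (f z).+1]. *)
- move=> z Cz; have [_ _] := nextP (f z, C (f z)) (PC _).
  by move=> /(_ z); apply => //; apply: (Cz (C (f z).+1)); exists (f z).+1.
by have [_ _ _ [z [? [/Cn0]]]] := PC n.
Qed.

End continua.

(** * Closed points and disjoint open sets in the series space *)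

Section series_space_theory.
Context (R : realType) (a : nat -> R) (a_gt0 : forall n, 0 < a n).

Lemma closed_series_space1 (n : series_space a_gt0) : closed [set n].
Proof.
apply/closed_series_spaceE; right.
by rewrite esum_set1 ?ltry// lee_fin ltW.
Qed.

Lemma series_space_disjoint_cvg (U V : set (series_space a_gt0)) :
  open U -> open V -> U !=set0 -> V !=set0 -> U `&` V = set0 ->
  cvgn (series a).
Proof.
have a_ge0 n : (0 <= (a n)%:E)%E by rewrite lee_fin ltW.
have fin (W : set (series_space a_gt0)) : open W -> W !=set0 ->
    (\esum_(n in ~` W) (a n)%:E < +oo)%E.
  move=> oW [x Wx]; have /closed_series_spaceE[WT|//] := open_closedC oW.
  by have : (~` W) x by rewrite WT.
move=> oU oV /(fin _ oU) Uoo /(fin _ oV) Voo UV0.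
apply: nnseries_is_cvg => [n|]; first exact: ltW.
rewrite nneseries_esumT//.
apply: (@le_lt_trans _ _
    (\esum_(n in ~` U) (a n)%:E + \esum_(n in ~` V) (a n)%:E)%E); last first.
  exact: lte_add_pinfty.
rewrite [X in (_ <= X + _)%E]esum_mkcond [X in (_ <= _ + X)%E]esum_mkcond.
rewrite -esumD; [|by move=> n _; case: ifP..].
(* Each index lies in at least one of the two complements, so its term is counted at least once on
   the right. *)
apply: le_esum => n _.
have : (~` U `|` ~` V) n by rewrite -setCI UV0 setC0.
by move=> [] /mem_set ->; case: ifP => _; rewrite ?adde0 ?add0e ?leeDl.
Qed.

End series_space_theory.

Lemma metrizable_separation (R : realType) (Y : topologicalType) (x y : Y) :
  metrizable_space R Y -> x <> y ->
  exists U V : set Y, [/\ open U, open V, U x, V y & U `&` V = set0].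
Proof.
move=> [d [d0 dC dT dO]] xy.
have dxx z : d z z = 0 by exact/d0.
have d_ge0 u v : 0 <= d u v.
  (* The triangle inequality through [u], [v], [u] reads [0 <= 2 d u v]. *)
  by have := dT u v u; rewrite dxx (dC v u) -mulr2n pmulrn_lge0.
have dxy : 0 < d x y.
  by rewrite lt_neqAle d_ge0 andbT eq_sym; apply/eqP => /d0.
have ballO z r : open [set w | d z w < r].
  apply/dO => w /= zw; exists (r - d z w); first by rewrite subr_gt0.
  by move=> v /= wv; apply: le_lt_trans (dT z w v) _; rewrite addrC -ltrBrDr.
exists [set w | d x w < d x y / 2], [set w | d y w < d x y / 2].
split => //=; rewrite ?dxx ?divr_gt0//.
rewrite -subset0 => z /= [xz yz].
have := dT x z y; rewrite (dC z y) leNgt => /negP; apply.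
by rewrite [ltRHS]splitr ltrD.
Qed.

Theorem theorem1p3 (R : realType) (a : nat -> R) (a_gt0 : forall n, 0 < a n) :
  (forall X : topologicalType,
     ([/\ compact [set: X], connected [set: X] & hausdorff_space X]
      \/ path_connected_space R X) ->
     forall f : X -> series_space a_gt0, continuous f -> is_constant f)
  /\
  (forall Y : topologicalType,
     metrizable_space R Y -> ~ cvgn (series a) ->
     forall f : series_space a_gt0 -> Y, continuous f -> is_constant f).
Proof.
split=> [X XP f cf|Y mY ncvg f cf]; last first.
  exists (f 0%N) => x; apply: contrapT => fx.
  have [U [V [oU oV Ux Vy UV0]]] := metrizable_separation mY fx.
  apply: ncvg; have pre := (continuousP _).1 cf.
  apply: (@series_space_disjoint_cvg _ _ a_gt0 (f @^-1` U) (f @^-1` V)).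
  - exact: pre.
  - exact: pre.
  - by exists x.
  - by exists 0%N.
  - by rewrite -preimage_setI UV0 preimage_set0.
suff fE x y : f x = f y.
  have [[x _]|X0] := pselect ([set: X] !=set0); first by exists (f x) => y.
  (* On the empty space an arbitrary value serves as the constant. *)
  by exists 0%N => x; exfalso; apply: X0; exists x.
case: XP => [[cX kX hX]|pX].
  apply: (sierpinski_continuum hX cX kX) => // n; rewrite setTI.
  by move/continuous_closedP : (cf); apply; exact: (@closed_series_space1 _ _ a_gt0 n).
have [g [cg <- <-]] := pX x y.
apply: (@sierpinski_continuum R (@Rhausdorff R) (f \o g) `[0, 1]).
- exact: segment_compact.
- exact: segment_connected.
(* As the segment is closed, closedness of the trace of a fibre can be tested in the subspace
   topology, for which [g] is continuous. *)
- move=> n; rewrite closed_setSI; last exact: interval_closed.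
  rewrite comp_preimage; move/continuous_closedP : cg; apply.
  by move/continuous_closedP : (cf); apply; exact: (@closed_series_space1 _ _ a_gt0 n).
- by rewrite /= in_itv/= lexx ler01.
- by rewrite /= in_itv/= lexx ler01.
Qed.
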